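(* Let $s$ be a positive integer and $a,b,\alpha,\beta\in\mathbb R$. Then the derivative of order $s$ (first definition) is linear: for $x>0$, $$\frac{d^s(ax^\alpha+bx^\beta)}{dx^s}=a\frac{d^sx^\alpha}{dx^s}+b\frac{d^sx^\beta}{dx^s}.$$
   Context: First definition. For $(s,\alpha)\in\mathbb Q\times\mathbb R\setminus\{(-1,-1)\}$ and $a\in\mathbb R$, a derivative of order $s$ of $ax^\alpha$ ($x>0$) is any function of the form $$\frac{d^s(ax^\alpha)}{dx^s}=a\frac{d^sx^\alpha}{dx^s}=a\frac{\Gamma(\alpha+1)}{\Gamma(\alpha-s+1)}x^{\alpha-s}+\sum_{k=-\infty}^{-1}c_k\frac{x^{k-s}}{\Gamma(k-s+1)},$$ with arbitrary real constants $c_k$; a derivative of order $s$ of $ax^\alpha+bx^\beta$ is any function of the form $$a\frac{\Gamma(\alpha+1)}{\Gamma(\alpha-s+1)}x^{\alpha-s}+b\frac{\Gamma(\beta+1)}{\Gamma(\beta-s+1)}x^{\beta-s}+\sum_{k=-\infty}^{-1}c_k\frac{x^{k-s}}{\Gamma(k-s+1)}.$$ Conventions: $1/\Gamma(z)=0$ for $z\in\{0,-1,-2,\dots\}$ (so for positive integer $s$ the sums vanish); $\Gamma(\alpha+1)/\Gamma(\alpha-s+1)$ means $\lim_{z\to\alpha}\Gamma(z+1)/\Gamma(z-s+1)$. *)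

(* Defs.v *)
From HB Require Import structures.
From mathcomp Require Import all_boot all_order all_algebra.
From mathcomp Require Import all_classical all_reals all_analysis.
Import Order.TTheory GRing.Theory Num.Theory numFieldNormedType.Exports.

Set Implicit Arguments.
Unset Strict Implicit.
Unset Printing Implicit Defensive.

Local Open Scope classical_set_scope.
Local Open Scope ring_scope.

(* Euler's integral; this is the Gamma function only for [0 < z]. *)
Definition euler_integral (R : realType) (z : R) : R :=
  \int[@lebesgue_measure R]_(t in `]0%R, +oo[) (t `^ (z - 1) * expR (- t)).

(* For [z <= 0] the integral is continued by
   Gamma(z) = Gamma(z + n) / (z (z + 1) ... (z + n - 1)), n being the least
   natural number with [0 < z + n]. The value at the poles is meaningless. *)
Definition Gamma (R : realType) (z : R) : R :=
  if 0 < z then euler_integral z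
  else let n := (Num.truncn (- z)).+1 in
       euler_integral (z + n%:R) / \prod_(i < n) (z + i%:R).

(* 1 / Gamma(z), with the convention that it vanishes at the poles of Gamma. *)
Definition rGamma (R : realType) (z : R) : R :=
  if `[< exists n : nat, z = - n%:R >] then 0 else (Gamma z)^-1.

(* Gamma(alpha + 1) / Gamma(alpha - s + 1), understood as a limit over
   z -> alpha with z != alpha. *)
Definition Gamma_ratio (R : realType) (s : rat) (alpha : R) : R :=
  lim (Gamma (z + 1) * rGamma (z - ratr s + 1) @[z --> alpha^']).

(* The functions on the positive half-line that are sums of a convergent series
   \sum_(k = -oo)^(-1) c_k x^(k - s) / Gamma(k - s + 1). The index k < 0 is
   [Negz n], that is -(n + 1), with n ranging over nat. *)
Definition complementary (R : realType) (s : rat) : set ({posnum R} -> R) :=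
  [set h | exists c : int -> R, forall x : {posnum R},
    series (fun n : nat => let k : R := (Negz n)%:~R in
      c (Negz n) * (x%:num `^ (k - ratr s) * rGamma (k - ratr s + 1)))
      @ \oo --> h x].

(* The derivatives of order s of the expression a x^alpha, x > 0. They are
   attached to the pair (a, alpha), and there may be many of them. *)
Definition deriv_monomial (R : realType) (s : rat) (a alpha : R) :
    set ({posnum R} -> R) :=
  [set f | (s, alpha) <> (-1, -1) /\ exists2 h, complementary s h &
    forall x : {posnum R},
      f x = a * Gamma_ratio s alpha * x%:num `^ (alpha - ratr s) + h x].

(* The derivatives of order s of the expression a x^alpha + b x^beta, x > 0:
   one complementary function for the whole expression. *)
Definition deriv_binomial (R : realType) (s : rat) (a alpha b beta : R) :
    set ({posnum R} -> R) :=
  [set f | [/\ (s, alpha) <> (-1, -1), (s, beta) <> (-1, -1) &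
    exists2 h, complementary s h &
    forall x : {posnum R},
      f x = a * Gamma_ratio s alpha * x%:num `^ (alpha - ratr s)
          + b * Gamma_ratio s beta * x%:num `^ (beta - ratr s) + h x]].

(* Main.v *)
Require Import Defs.
From HB Require Import structures.
From mathcomp Require Import all_boot all_order all_algebra.
From mathcomp Require Import all_classical all_reals all_analysis.
From mathcomp Require Import ring.
Import Order.TTheory GRing.Theory Num.Theory numFieldNormedType.Exports.
Local Open Scope classical_set_scope.
Local Open Scope ring_scope.

(** Multi-valued derivatives are linear at a natural order [s] because they are
    single-valued there. For [k <= -1] the integer
    [k - s + 1] is at most [- s], hence a pole of Gamma, so every term of a
    complementary series carries the factor [1 / Gamma (k - s + 1) = 0] whatever
    the constants are ([rGamma_complementary]). The zero function is therefore
    the only complementary function ([complementary_nat]), and both sides of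
    the identity reduce to the singleton of
    [a * Gamma_ratio s alpha * x `^ (alpha - s) +
     b * Gamma_ratio s beta * x `^ (beta - s)]. *)

(** The argument is the pole [- (n + s)] of Gamma: the [+ 1] cancels against
    the shift in [Negz n = - (n + 1)]. *)
Lemma rGamma_complementary (R : realType) (s n : nat) :
  rGamma ((Negz n)%:~R - ratr (s%:R : rat) + 1 : R) = 0.
Proof.
rewrite /rGamma asboolT//; exists (n + s)%N.
by rewrite ratr_nat NegzE mulrNz -pmulrn -[n.+1]addn1 !natrD; ring.
Qed.

(** All partial sums vanish, so the series converges to [0] for any choice of
    constants; uniqueness of limits excludes any other function. *)
Lemma complementary_nat (R : realType) (s : nat) :
  complementary (s%:R : rat) = [set (fun=> 0)] :> set ({posnum R} -> R).
Proof.
have series0 (c : int -> R) (x : {posnum R}) :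
    series (fun n : nat => let k : R := (Negz n)%:~R in
      c (Negz n) * (x%:num `^ (k - ratr (s%:R : rat))
                    * rGamma (k - ratr (s%:R : rat) + 1))) = fun=> 0.
  apply/funext => N; rewrite /series /= big1// => n _.
  by rewrite rGamma_complementary !mulr0.
apply/seteqP; split => [h [c ch]|h ->].
  apply/funext => x.
  have h0 : (fun=> 0 : R) @ \oo --> h x by rewrite -(series0 c x); exact: ch.
  by apply: (cvg_unique _ h0); [exact: norm_hausdorff|exact: cvg_cst].
by exists (fun=> 0) => x; rewrite (series0 (fun=> 0) x); exact: cvg_cst.
Qed.

(** The excluded pair of the definition can only occur at order [-1]. *)
Lemma order_nat_neqN1 (R : realType) (s : nat) (alpha : R) :
  ((s%:R : rat), alpha) <> (-1, -1).
Proof. by case=> sN1 _; have := ler0n rat s; rewrite sN1. Qed.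

Lemma deriv_monomial_nat (R : realType) (s : nat) (a alpha : R) :
  deriv_monomial (s%:R : rat) a alpha =
  [set fun x : {posnum R} => a * Gamma_ratio (s%:R : rat) alpha
    * x%:num `^ (alpha - ratr (s%:R : rat))].
Proof.
rewrite /deriv_monomial complementary_nat.
apply/seteqP; split => [f [_ [h -> fE]]|f ->].
  by apply/funext => x; rewrite fE addr0.
split; first exact: order_nat_neqN1.
by exists (fun=> 0) => // x; rewrite addr0.
Qed.

Lemma deriv_binomial_nat (R : realType) (s : nat) (a alpha b beta : R) :
  deriv_binomial (s%:R : rat) a alpha b beta =
  [set fun x : {posnum R} =>
    a * Gamma_ratio (s%:R : rat) alpha
      * x%:num `^ (alpha - ratr (s%:R : rat))
    + b * Gamma_ratio (s%:R : rat) beta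
      * x%:num `^ (beta - ratr (s%:R : rat))].
Proof.
rewrite /deriv_binomial complementary_nat.
apply/seteqP; split => [f [_ _ [h -> fE]]|f ->].
  by apply/funext => x; rewrite fE addr0.
split; [exact: order_nat_neqN1|exact: order_nat_neqN1|].
by exists (fun=> 0) => // x; rewrite addr0.
Qed.

Theorem theorem3p6 (R : realType) (s : nat) (hs : (0 < s)%N)
    (a b alpha beta : R) :
  deriv_binomial (s%:R : rat) a alpha b beta =
  [set (fun x : {posnum R} => a * f x + b * g x)
    | f in deriv_monomial (s%:R : rat) 1 alpha
    & g in deriv_monomial (s%:R : rat) 1 beta].
Proof.
rewrite deriv_binomial_nat !deriv_monomial_nat.
apply/seteqP; split => [_ ->|_ [_ -> [_ -> <-]]].
  do 2!(eexists; first by []).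
  by apply/funext => x; rewrite !mul1r !mulrA.
by apply/funext => x; rewrite !mul1r !mulrA.
Qed.
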